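(* The rank-zero fragment of $\mathsf{WRP}$ coincides with the class of polyregular maps. That is, for a partial map $T\colon\Sigma^*\rightharpoonup\Gamma^*$ between words over finite alphabets the following are equivalent: (a) $T$ has a $\mathsf{WRP}$ presentation of rank dimension $d=0$; (b) $T$ has a $\mathsf{WRP}$ presentation in which every prefix-additive rank function is identically zero; (c) $T$ is polyregular. Consequently, every polyregular map is a $\mathsf{WRP}$ map.
   Context: **MSO on words.** A word $w=a_1\cdots a_n$ over a finite alphabet $\Sigma$ is a structure with universe $\mathrm{Pos}(w)=\{1,\dots,n\}$, the order $<$, and unary predicates $P_a$ ($a\in\Sigma$) with $P_a(i)$ iff $a_i=a$. MSO formulas are built from $x<y$, $x=y$, $P_a(x)$, $x\in X$ by Boolean connectives and quantification over positions and over sets of positions. $w\models\varphi(i_1,\dots,i_k)$ denotes satisfaction. **Polyregular maps.** A polyregular presentation (input alphabet $\Sigma$, output alphabet $\Gamma$, both finite) consists of: a nonempty finite set $C$ of copy names, each $c\in C$ with an arity $k_c\ge1$; an MSO domain sentence $\varphi_{\mathrm{dom}}$; for each $c$ an MSO selection formula $\varphi_c(x_1,\dots,x_{k_c})$, giving the set of selected atoms $\mathrm{At}(w)=\{(c,\bar i):c\in C,\ \bar i\in\mathrm{Pos}(w)^{k_c},\ w\models\varphi_c(\bar i)\}$; for each $c$ and $\gamma\in\Gamma$ an MSO label formula $\psi_{c,\gamma}(x_1,\dots,x_{k_c})$ such that each selected atom $(c,\bar i)$ satisfies exactly one of them, that $\gamma$ being its label; and for each pair $c,c'\in C$ an MSO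 ordering formula $\chi_{c,c'}(\bar x,\bar y)$, such that on each $w$ these define a strict linear order $\chi$ on $\mathrm{At}(w)$. It determines the partial map $f\colon\Sigma^*\rightharpoonup\Gamma^*$ with domain $\{w:w\models\varphi_{\mathrm{dom}}\}$ whose value $f(w)$ is the concatenation of the labels of the selected atoms listed in increasing $\chi$-order. A partial map is polyregular if it is determined by some such presentation. **Rank functions.** A $d$-dimensional deterministic additive rank source over $\Sigma$ is $A=(Q,q_0,\delta,\omega)$ with $Q$ a finite set, $q_0\in Q$, $\delta\colon Q\times\Sigma\to Q$, $\omega\colon Q\times\Sigma\to\mathbb Z^d$. On $w=a_1\cdots a_n$ put $q_i=\delta(q_{i-1},a_i)$; for $1\le i\le n+1$ the prefix rank is $\rho_A^w(i)=\sum_{j<i}\omega(q_{j-1},a_j)$, and $q^A_i:=q_{i-1}$ is the state just before position $i$. A $d$-dimensional prefix-additive rank function on $k$-tuples of positions is a function of the form $\kappa^w(x_1,\dots,x_k)=c_0+\sum_{r=1}^k\bigl(\rho_{A_r}^w(x_r)+\beta_r(q^{A_r}_{x_r},a_{x_r})\bigr)$, with $c_0\in\mathbb Z^d$ fixed, $A_r$ fixed $d$-dimensional rank sources with state sets $Q_r$, and $\beta_r\colon Q_r\times\Sigma\to\mathbb Z^d$ fixed tables. **WRP.** A $\mathsf{WRP}$ presentation is a polyregular presentation together with a fixed rank dimension $d\ge0$ and, for each $c\in C$, a $d$-dimensional prefix-additive rank function $\kappa_c$ on $k_c$-tuples. Selected atoms are ordered by $(c,\bar i)\prec(c',\bar i')$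 iff $\kappa_c^w(\bar i)<_{\mathrm{lex}}\kappa_{c'}^w(\bar i')$, or these vectors are equal and $(c,\bar i)$ precedes $(c',\bar i')$ in $\chi$. The associated partial map has domain $\{w:w\models\varphi_{\mathrm{dom}}\}$ and value the concatenation of the labels of the selected atoms in increasing $\prec$-order. $\mathsf{WRP}$ is the class of partial maps so obtained. *)

(* Defs.v *)
From HB Require Import structures.
From mathcomp Require Import all_boot all_order all_algebra.

Set Implicit Arguments.
Unset Strict Implicit.
Unset Printing Implicit Defensive.

Import Order.TTheory GRing.Theory Num.Theory.
Local Open Scope ring_scope.

(** A word over [Sigma] is a [seq Sigma]; its positions are the elements of
    ['I_(size w)], so they are numbered from 0 rather than from 1. *)

Definition letter (Sigma : finType) (w : seq Sigma) (i : 'I_(size w)) : Sigma :=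
  tnth (in_tuple w) i.

(** [mso Sigma n m]: formulas whose free position variables are among ['I_n]
    and free set variables among ['I_m]. Binding is by de Bruijn indices: a
    quantifier binds index 0 of its body and shifts the other indices of the
    same sort by one. *)
Inductive mso (Sigma : finType) : nat -> nat -> Type :=
| mso_lt n m (x y : 'I_n) : mso Sigma n m
| mso_eq n m (x y : 'I_n) : mso Sigma n m
| mso_letter n m (a : Sigma) (x : 'I_n) : mso Sigma n m
| mso_mem n m (x : 'I_n) (X : 'I_m) : mso Sigma n m
| mso_not n m (phi : mso Sigma n m) : mso Sigma n m
| mso_and n m (phi psi : mso Sigma n m) : mso Sigma n m
| mso_or n m (phi psi : mso Sigma n m) : mso Sigma n m
| mso_ex n m (phi : mso Sigma n.+1 m) : mso Sigma n m
| mso_all n m (phi : mso Sigma n.+1 m) : mso Sigma n m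
| mso_exset n m (phi : mso Sigma n m.+1) : mso Sigma n m
| mso_allset n m (phi : mso Sigma n m.+1) : mso Sigma n m.

Fixpoint sat (Sigma : finType) (w : seq Sigma) n m (phi : mso Sigma n m) :
    n.-tuple 'I_(size w) -> m.-tuple {set 'I_(size w)} -> bool :=
  match phi in mso _ n m
    return n.-tuple 'I_(size w) -> m.-tuple {set 'I_(size w)} -> bool with
  | mso_lt _ _ x y => fun e _ => (tnth e x < tnth e y)%N
  | mso_eq _ _ x y => fun e _ => tnth e x == tnth e y
  | mso_letter _ _ a x => fun e _ => letter (tnth e x) == a
  | mso_mem _ _ x X => fun e E => tnth e x \in tnth E X
  | mso_not _ _ phi => fun e E => ~~ sat phi e E
  | mso_and _ _ phi psi => fun e E => sat phi e E && sat psi e E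
  | mso_or _ _ phi psi => fun e E => sat phi e E || sat psi e E
  | mso_ex _ _ phi => fun e E =>
      [exists i : 'I_(size w), sat phi [tuple of i :: e] E]
  | mso_all _ _ phi => fun e E =>
      [forall i : 'I_(size w), sat phi [tuple of i :: e] E]
  | mso_exset _ _ phi => fun e E =>
      [exists A : {set 'I_(size w)}, sat phi e [tuple of A :: E]]
  | mso_allset _ _ phi => fun e E =>
      [forall A : {set 'I_(size w)}, sat phi e [tuple of A :: E]]
  end.

(** Formulas [phi(x_1, ..., x_k)] with free position variables only. *)
Definition mso_formula (Sigma : finType) (k : nat) : Type := mso Sigma k 0.

Definition models (Sigma : finType) (w : seq Sigma) k
    (phi : mso_formula Sigma k) (i : k.-tuple 'I_(size w)) : bool :=
  sat phi i [tuple].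

(** The data of a polyregular presentation, before the conditions on labels and
    on the order are imposed. *)
Record polyregular_data (Sigma Gamma : finType) := PolyregularData {
  copy : finType;
  copy_nonempty : (0 < #|copy|)%N;
  arity : copy -> nat;
  arity_gt0 : forall c, (0 < arity c)%N;
  dom_sentence : mso_formula Sigma 0;
  selection : forall c, mso_formula Sigma (arity c);
  labelling : forall c, Gamma -> mso_formula Sigma (arity c);
  ordering : forall c c', mso_formula Sigma (arity c + arity c')%N
}.

Section Atoms.
Variables (Sigma Gamma : finType) (P : polyregular_data Sigma Gamma).
Variable w : seq Sigma.

Definition in_dom : bool := models (dom_sentence P) ([tuple] : 0.-tuple 'I_(size w)).

Definition atom : finType := {c : copy P & (arity c).-tuple 'I_(size w)}.

Definition selected : {set atom} :=
  [set a : atom | models (selection (tag a)) (tagged a)].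

Definition has_label (a : atom) (g : Gamma) : bool :=
  models (labelling (tag a) g) (tagged a).

Definition chi : rel atom := fun a b =>
  models (ordering (tag a) (tag b)) [tuple of tagged a ++ tagged b].

(** [[pick g | has_label a g]] is the label of [a] as soon as that label is
    unique. The relation [lt] is strict; [sort] expects its reflexive closure. *)
Definition output (lt : rel atom) : seq Gamma :=
  pmap (fun a => [pick g | has_label a g])
       (sort (fun a b => (a == b) || lt a b) (enum selected)).

End Atoms.

Definition strict_linear_on (T : finType) (A : {set T}) (R : rel T) : Prop :=
  [/\ {in A, forall a, ~~ R a a},
      {in A & &, forall b a c, R a b -> R b c -> R a c} &
      {in A &, forall a b, a != b -> R a b || R b a}].

Record polyregular_presentation (Sigma Gamma : finType) := PolyregularPresentation {
  pdata :> polyregular_data Sigma Gamma;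
  label_unique : forall (w : seq Sigma) (a : atom pdata w),
    a \in selected pdata w -> exists! g : Gamma, has_label a g;
  chi_strict_linear : forall w : seq Sigma,
    strict_linear_on (selected pdata w) (@chi _ _ pdata w)
}.

(** Partial maps [Sigma^* -> Gamma^*] are functions
    [seq Sigma -> option (seq Gamma)]. *)
Definition polyregular_map (Sigma Gamma : finType)
    (P : polyregular_presentation Sigma Gamma) (w : seq Sigma) :
    option (seq Gamma) :=
  if in_dom P w then Some (output (@chi _ _ P w)) else None.

Definition polyregular (Sigma Gamma : finType)
    (T : seq Sigma -> option (seq Gamma)) : Prop :=
  exists P : polyregular_presentation Sigma Gamma, T =1 polyregular_map P.

Record rank_source (Sigma : finType) (d : nat) := RankSource {
  rstate : finType;
  rinit : rstate;
  rstep : rstate -> Sigma -> rstate;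
  rweight : rstate -> Sigma -> 'rV[int]_d
}.

(** The state just before the 0-based position [i]. *)
Definition state_before (Sigma : finType) d (A : rank_source Sigma d)
    (w : seq Sigma) (i : nat) : rstate A :=
  foldl (@rstep _ _ A) (rinit A) (take i w).

Definition prefix_rank (Sigma : finType) d (A : rank_source Sigma d)
    (w : seq Sigma) (i : nat) : 'rV[int]_d :=
  \sum_(j < size w | (j < i)%N) rweight (state_before A w j) (letter j).

Record rank_function (Sigma : finType) (d k : nat) := RankFunction {
  rconst : 'rV[int]_d;
  rsource : 'I_k -> rank_source Sigma d;
  rtable : forall r : 'I_k, rstate (rsource r) -> Sigma -> 'rV[int]_d
}.

Definition rank_value (Sigma : finType) d k (kappa : rank_function Sigma d k)
    (w : seq Sigma) (x : k.-tuple 'I_(size w)) : 'rV[int]_d :=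
  rconst kappa +
  \sum_(r < k)
    (prefix_rank (rsource kappa r) w (tnth x r) +
     rtable (state_before (rsource kappa r) w (tnth x r)) (letter (tnth x r))).

Definition lt_lex d (u v : 'rV[int]_d) : bool :=
  (([tuple u 0 i | i < d] : d.-tuplelexi int) < [tuple v 0 i | i < d])%O.

Record wrp_presentation (Sigma Gamma : finType) := WRPPresentation {
  wrp_base :> polyregular_presentation Sigma Gamma;
  rank_dim : nat;
  wrp_rank : forall c : copy wrp_base,
    rank_function Sigma rank_dim (arity c)
}.

Definition wrp_prec (Sigma Gamma : finType) (P : wrp_presentation Sigma Gamma)
    (w : seq Sigma) : rel (atom P w) := fun a b =>
  let ka := rank_value (wrp_rank (tag a)) (tagged a) in
  let kb := rank_value (wrp_rank (tag b)) (tagged b) in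
  lt_lex ka kb || (ka == kb) && chi a b.

Definition wrp_map (Sigma Gamma : finType) (P : wrp_presentation Sigma Gamma)
    (w : seq Sigma) : option (seq Gamma) :=
  if in_dom P w then Some (output (@wrp_prec _ _ P w)) else None.

Definition is_wrp (Sigma Gamma : finType)
    (T : seq Sigma -> option (seq Gamma)) : Prop :=
  exists P : wrp_presentation Sigma Gamma, T =1 wrp_map P.

Definition ranks_identically_zero (Sigma Gamma : finType)
    (P : wrp_presentation Sigma Gamma) : Prop :=
  forall (c : copy P) (w : seq Sigma) (x : (arity c).-tuple 'I_(size w)),
    rank_value (wrp_rank c) x = 0.

(* Main.v *)
Require Import Defs.
From mathcomp Require Import all_boot all_order all_algebra.

(** The order of a presentation with ranks compares rank vectors first and falls
    back on [chi] when they agree. If all rank vectors are zero they always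
    agree, so this order is [chi], and the presentation determines the map of
    its underlying polyregular presentation ([wrp_map_zero_ranks]); this gives
    (b) -> (c). Since the only vector of dimension 0 is the zero vector, (a)
    yields (b) with the same presentation. Conversely, any polyregular
    presentation can be decorated with the trivial ranks of dimension 0
    ([unranked]), whose ranks vanish, so that its map is unchanged; this gives
    (c) -> (a) and the inclusion of polyregular maps in WRP. *)

Lemma rowdim0 {R : nmodType} {d} (v : 'rV[R]_d) : d = 0%N -> v = 0%R.
Proof. by move=> d0; move: v; rewrite d0 => v; apply: thinmx0. Qed.

Lemma wrp_prec_zero_ranks {Sigma Gamma : finType}
    {P : wrp_presentation Sigma Gamma} (w : seq Sigma) :
  ranks_identically_zero P -> @wrp_prec _ _ P w =2 @chi _ _ P w.
Proof.
by move=> P0 a b; rewrite /wrp_prec !P0 /lt_lex Order.POrderTheory.ltxx eqxx.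
Qed.

(** The identity is monotone from one relation to the other, and sorting
    commutes with monotone maps. *)
Lemma eq_rel_sort {T : Type} {leT leT' : rel T} :
  leT =2 leT' -> sort leT =1 sort leT'.
Proof.
move=> eq_le s; have id_mono : {mono id : x y / leT' x y >-> leT x y} by [].
by rewrite -[s in LHS]map_id -(map_sort id_mono) map_id.
Qed.

Lemma eq_output {Sigma Gamma : finType} {P : polyregular_data Sigma Gamma}
    {w : seq Sigma} {lt1 lt2 : rel (atom P w)} :
  lt1 =2 lt2 -> output lt1 = output lt2.
Proof.
by move=> eq_lt; congr pmap; apply: eq_rel_sort => a b; rewrite eq_lt.
Qed.

Lemma wrp_map_zero_ranks {Sigma Gamma : finType}
    {P : wrp_presentation Sigma Gamma} :
  ranks_identically_zero P -> wrp_map P =1 polyregular_map P.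
Proof.
move=> P0 w; rewrite /wrp_map /polyregular_map.
by rewrite (eq_output (wrp_prec_zero_ranks w P0)).
Qed.

Lemma rank_dim0_zero_ranks {Sigma Gamma : finType}
    {P : wrp_presentation Sigma Gamma} :
  rank_dim P = 0%N -> ranks_identically_zero P.
Proof. by move=> d0 c w x; apply: rowdim0. Qed.

Definition unit_source (Sigma : finType) : rank_source Sigma 0 :=
  RankSource tt (fun _ _ => tt) (fun _ (_ : Sigma) => 0%R).

Definition unit_rank (Sigma : finType) (k : nat) : rank_function Sigma 0 k :=
  @RankFunction Sigma 0 k 0%R (fun _ => unit_source Sigma) (fun _ _ _ => 0%R).

Definition unranked {Sigma Gamma : finType}
    (P : polyregular_presentation Sigma Gamma) : wrp_presentation Sigma Gamma :=
  WRPPresentation (fun c : copy P => unit_rank Sigma (arity c)).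

Lemma wrp_map_unranked {Sigma Gamma : finType}
    (P : polyregular_presentation Sigma Gamma) :
  wrp_map (unranked P) =1 polyregular_map P.
Proof. exact/wrp_map_zero_ranks/rank_dim0_zero_ranks. Qed.

Theorem proposition4p8 (Sigma Gamma : finType)
    (T : seq Sigma -> option (seq Gamma)) :
  [<-> (exists2 P : wrp_presentation Sigma Gamma, rank_dim P = 0%N & T =1 wrp_map P);
       (exists2 P : wrp_presentation Sigma Gamma, ranks_identically_zero P & T =1 wrp_map P);
       polyregular T]
  /\ (polyregular T -> is_wrp T).
Proof.
have TP P : T =1 polyregular_map P -> T =1 wrp_map (unranked P).
  by move=> PT w; rewrite PT wrp_map_unranked.
split; last by case=> P /TP; exists (unranked P).
tfae.
- by case=> P d0 PT; exists P => //; apply: rank_dim0_zero_ranks.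
- by case=> P P0 PT; exists P => w; rewrite PT wrp_map_zero_ranks.
- by case=> P /TP; exists (unranked P).
Qed.
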